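(* Let $n\ge 2$ be an integer. Let $\mathfrak{A}$ and $\mathfrak{A}'$ be two $C^*$-algebras with identities $I_{\mathfrak{A}}$ and $I_{\mathfrak{A}'}$, respectively, let $P_1$ and $P_2=I_{\mathfrak{A}}-P_1$ be nontrivial projections in $\mathfrak{A}$, and let $\varphi:\mathfrak{A}\to\mathfrak{A}'$ be a map. Suppose that for each $i\in\{1,2\}$: for $X\in\mathfrak{A}$, $X\mathfrak{A}P_i=\{0\}$ implies $X=0$; and for $Y\in\mathfrak{A}'$, $Y\mathfrak{A}'\varphi(P_i)=\{0\}$ implies $Y=0$. Then $\varphi$ is a bijective unital multiplicative $*$-Jordan $n$-map if and only if $\varphi$ is a $*$-ring isomorphism.
   Context: $C^*$-algebras are complex. For elements $A,B$ of a $*$-ring, $\{A,B\}_*:=AB+BA^*$ (the $*$-Jordan product). Define $q_{1*}(x)=x$ and $q_{n*}(x_1,\dots,x_n)=\{q_{(n-1)*}(x_1,\dots,x_{n-1}),x_n\}_*$ for $n\ge 2$. A map $\varphi$ (not necessarily additive) is a multiplicative $*$-Jordan $n$-map if $\varphi(q_{n*}(x_1,\dots,x_n))=q_{n*}(\varphi(x_1),\dots,\varphi(x_n))$ for all $x_1,\dots,x_n$. A projection is a self-adjoint idempotent; it is nontrivial if it is neither $0$ nor the identity. Unital means $\varphi(I_{\mathfrak{A}})=I_{\mathfrak{A}'}$. A $*$-ring isomorphism is a bijective map that is additive, multiplicative and satisfies $\varphi(A^* )=\varphi(A)^*$ (complex linearity is not required). *)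

(* Defs.v *)
From HB Require Import structures.
From mathcomp Require Import all_boot all_order all_algebra.
From mathcomp Require Import complex.
From mathcomp Require Import reals.
Set Implicit Arguments.
Unset Strict Implicit.
Unset Printing Implicit Defensive.
Import Order.TTheory GRing.Theory Num.Theory.
Local Open Scope ring_scope.

(* The norm is a field of the mixin because Num.NumDomain is already the join
   of rings and normed Z-modules in the hierarchy: a structure inheriting both
   from algType and from normedModType cannot be declared.
   algType gives the identity, and requires it to be nonzero. *)
HB.mixin Record isCStarAlgebra (R : realType) A of GRing.Algebra R[i] A := {
  star : A -> A;
  starK : involutive star;
  starD : forall x y : A, star (x + y) = star x + star y;
  starZ : forall (a : R[i]) (x : A), star (a *: x) = a^* *: star x;
  starM : forall x y : A, star (x * y) = star y * star x;
  cnorm : A -> R;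
  cnorm_ge0 : forall x : A, 0 <= cnorm x;
  cnorm0_eq0 : forall x : A, cnorm x = 0 -> x = 0;
  cnormD_le : forall x y : A, cnorm (x + y) <= cnorm x + cnorm y;
  cnormZ : forall (a : R[i]) (x : A), cnorm (a *: x) = Normc.normc a * cnorm x;
  cnormM_le : forall x y : A, cnorm (x * y) <= cnorm x * cnorm y;
  cnorm_complete : forall u : nat -> A,
    (forall e : R, 0 < e -> exists N : nat, forall m n : nat,
      (N <= m)%N -> (N <= n)%N -> cnorm (u m - u n) < e) ->
    exists l : A, forall e : R, 0 < e -> exists N : nat, forall n : nat,
      (N <= n)%N -> cnorm (u n - l) < e;
  cnorm_starM : forall x : A, cnorm (star x * x) = cnorm x ^+ 2
}.

#[short(type="cstarAlgType")]
HB.structure Definition CStarAlgebra (R : realType) :=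
  {A of GRing.Algebra R[i] A & isCStarAlgebra R A}.

Section StarJordan.
Variables (R : realType) (A : cstarAlgType R).
Implicit Types (x y p : A) (s : seq A).

Definition jordan_star x y : A := x * y + y * star x.

(* The value on the empty sequence is junk. *)
Definition qstar s : A := if s is x :: s' then foldl jordan_star x s' else 0.

Lemma qstar1 x : qstar [:: x] = x.
Proof. by []. Qed.

Lemma qstar_rcons s x :
  s != [::] -> qstar (rcons s x) = jordan_star (qstar s) x.
Proof. by case: s => //= y s _; rewrite foldl_rcons. Qed.

Definition projection p : Prop := star p = p /\ p * p = p.

Definition nontrivial_projection p : Prop :=
  [/\ projection p, p <> 0 & p <> 1].

End StarJordan.

Section Maps.
Variables (R : realType) (A A' : cstarAlgType R).

Definition star_jordan_nmap (n : nat) (phi : A -> A') : Prop :=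
  forall x : n.-tuple A, phi (qstar x) = qstar (map phi x).

Definition star_ring_isomorphism (phi : A -> A') : Prop :=
  [/\ bijective phi,
      {morph phi : x y / x + y},
      {morph phi : x y / x * y}
    & {morph phi : x / star x}].

End Maps.

(* Main.v *)
Require Import Defs.
From mathcomp Require Import all_boot all_order all_algebra.
From mathcomp Require Import complex reals.
Import GRing.Theory Num.Theory.
Local Open Scope ring_scope.
Set Implicit Arguments.
Unset Strict Implicit.

(** The converse direction is immediate, so let [phi] be a unital bijective
    n-map and write {a, b} for [jordan_star a b].  Since {1, x} = 2x, filling
    the first n - 2 slots with 1 turns the n-ary hypothesis into the binary one
      phi (k {a, b}) = k {phi a, phi b}   with k = 2^(n-2).      (J)
    The factor k cannot be removed yet, because [phi] is not known to be
    additive; everything in the additivity part is carried out with it.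

    Additivity.  Let t be the element with phi t = phi a + phi b.  By (J) and
    biadditivity of the product, phi (k {c, t}) = phi (k {c, a}) +
    phi (k {c, b}) for every c.  If [phi] is already additive at the pair
    (k {c, a}, k {c, b}), for instance because one entry vanishes, injectivity
    gives {c, t - (a + b)} = 0 ([jordan_separatel], and [jordan_separater] for
    c on the other side).  Testing with P, Q = 1 - P and P - Q kills the Peirce
    components of t - (a + b), so that [phi] is additive across different
    corners ([phi_peirce]).  Inside the corner P A Q the product of P + a and
    Q + b contains a + b and produces the sum from the previous case
    ([additive_at_offdiag_same]).  Inside P A P one multiplies into P A Q, and
    the hypothesis that X A Q = 0 forces X = 0 concludes ([additive_at_diag]).

    Multiplicativity.  Once [phi] is additive, (J) says that it preserves
    {a, b}; taking b = 1 it preserves the involution.  Let j = phi i.  As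
    {i, b} = 0 and j* = -j, the element j is central.  The number i acts twice
    on the off-diagonal part of A through x |-> {i P, x} = i (P x - x P), with
    square -1; the corresponding map in A' is multiplication by j on
    phi P A' phi Q, so that j^2 + 1 annihilates that corner
    ([phi_i_square_corner]).  The hypothesis on A' then gives j^2 = -1, hence
    phi (i x) = j phi x.  Replacing a by i a in phi {a, b} = {phi a, phi b}
    shows that [phi] also preserves a b - b a*, and adding the two identities
    gives phi (a b) = phi a phi b ([phi_mul]). *)

(** * The star-Jordan product *)

Section StarAlgebra.
Variables (R : realType) (A : cstarAlgType R).
Implicit Types (a b c p q x y z : A).

Lemma star1 : star (1 : A) = 1.
Proof. by have := starM (star (1 : A)) 1; rewrite mulr1 starK mulr1 => <-. Qed.

Lemma double_inj x y : x + x = y + y -> x = y.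
Proof.
have n2 : (2%:R : R[i]) != 0 by rewrite pnatr_eq0.
by move=> e; apply: (scalerI n2); rewrite !scaler_nat !mulr2n.
Qed.

Lemma jordan_starDl a b c :
  jordan_star (a + b) c = jordan_star a c + jordan_star b c.
Proof. by rewrite /jordan_star starD mulrDl mulrDr addrACA. Qed.

Lemma jordan_starDr c a b :
  jordan_star c (a + b) = jordan_star c a + jordan_star c b.
Proof. by rewrite /jordan_star mulrDl mulrDr addrACA. Qed.

Lemma starN x : star (- x) = - star x.
Proof.
apply: (addIr (star x)); rewrite -starD !addNr.
by apply: (addIr (star (0 : A))); rewrite -starD !add0r.
Qed.

Lemma jordan_starNl a c : jordan_star (- a) c = - jordan_star a c.
Proof. by rewrite /jordan_star starN mulNr mulrN opprD. Qed.

Lemma jordan_starNr c a : jordan_star c (- a) = - jordan_star c a.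
Proof. by rewrite /jordan_star mulNr mulrN opprD. Qed.

Lemma jordan_star0r c : jordan_star c 0 = 0.
Proof. by rewrite /jordan_star mul0r mulr0 addr0. Qed.

Lemma jordan_star0l c : jordan_star 0 c = 0.
Proof.
by rewrite -[X in jordan_star X _](subrr 0) jordan_starDl jordan_starNl subrr.
Qed.

Lemma jordan_star1l x : jordan_star 1 x = x + x.
Proof. by rewrite /jordan_star star1 mul1r mulr1. Qed.

Lemma jordan_star1r x : jordan_star x 1 = x + star x.
Proof. by rewrite /jordan_star mulr1 mul1r. Qed.

Lemma jordan_starMnl a c m : jordan_star (a *+ m) c = jordan_star a c *+ m.
Proof.
elim: m => [|m IH]; first by rewrite !mulr0n jordan_star0l.
by rewrite !mulrS jordan_starDl IH.
Qed.

Lemma jordan_star_sub_eq0l c x y :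
  jordan_star c x = jordan_star c y -> jordan_star c (x - y) = 0.
Proof. by move=> e; rewrite jordan_starDr jordan_starNr e subrr. Qed.

Lemma jordan_star_sub_eq0r c x y :
  jordan_star x c = jordan_star y c -> jordan_star (x - y) c = 0.
Proof. by move=> e; rewrite jordan_starDl jordan_starNl e subrr. Qed.

(** The leading ones only contribute a power of two: this is how the n-ary
    hypothesis gives information on the binary product. *)
Lemma qstar_ones m a b :
  qstar (ncons m 1 [:: a; b]) = jordan_star a b *+ 2 ^ m.
Proof.
(* The running value of the fold after some ones is a multiple of 1. *)
have ones l i : foldl (@jordan_star R A) (1 *+ l) (ncons i 1 [:: a; b]) =
    jordan_star a b *+ (2 * l * 2 ^ i).
  elim: i l => [|i IH] l /=.
    rewrite jordan_starMnl jordan_star1l -mulr2n -mulrnA jordan_starMnl.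
    by rewrite expn0 muln1.
  rewrite jordan_starMnl jordan_star1l -mulr2n -mulrnA IH.
  by rewrite expnS !mulnA (mulnAC 2 l 2).
case: m => [|m]; first by rewrite expn0 mulr1n.
by rewrite /= -[X in foldl _ X]mulr1n ones muln1 expnS.
Qed.

Lemma scale_corner (l : R[i]) p q x : l *: (p * x * q) = p * (l *: x) * q.
Proof. by rewrite -scalerAr -scalerAl. Qed.

Lemma scale_jordan_starDl (l : R[i]) a b c :
  l *: jordan_star (a + b) c = l *: jordan_star a c + l *: jordan_star b c.
Proof. by rewrite jordan_starDl scalerDr. Qed.

Lemma scale_jordan_starDr (l : R[i]) c a b :
  l *: jordan_star c (a + b) = l *: jordan_star c a + l *: jordan_star c b.
Proof. by rewrite jordan_starDr scalerDr. Qed.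

End StarAlgebra.

(** * Additivity *)

Section Additivity.
Variables (R : realType) (A A' : cstarAlgType R) (k : R[i]) (phi : A -> A').
Hypotheses (k_neq0 : k != 0) (phi_bij : bijective phi).
Hypothesis phi_jordan : forall a b : A,
  phi (k *: jordan_star a b) = k *: jordan_star (phi a) (phi b).
Implicit Types (a b c x y t : A).

Definition additive_at a b := phi (a + b) = phi a + phi b.

Lemma phi0 : phi 0 = 0.
Proof.
have [g _ gK] := phi_bij.
have := phi_jordan 0 (g 0).
by rewrite gK jordan_star0l jordan_star0r !scaler0.
Qed.

Lemma additive_at0l x : additive_at 0 x.
Proof. by rewrite /additive_at phi0 !add0r. Qed.

Lemma additive_at0r x : additive_at x 0.
Proof. by rewrite /additive_at phi0 !addr0. Qed.

Lemma phi_scale_inj x y : phi (k *: x) = phi (k *: y) -> x = y.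
Proof. by move/(bij_inj phi_bij)/(scalerI k_neq0). Qed.

(** An element t whose image is phi a + phi b behaves like a + b under those
    products with c for which the sum is already known to be preserved. *)
Lemma jordan_separatel c a b t : phi t = phi a + phi b ->
    additive_at (k *: jordan_star c a) (k *: jordan_star c b) ->
  jordan_star c (t - (a + b)) = 0.
Proof.
move=> et ad; apply: jordan_star_sub_eq0l; apply: phi_scale_inj.
rewrite phi_jordan et scale_jordan_starDr -!phi_jordan -ad.
by rewrite -scale_jordan_starDr.
Qed.

Lemma jordan_separater c a b t : phi t = phi a + phi b ->
    additive_at (k *: jordan_star a c) (k *: jordan_star b c) ->
  jordan_star (t - (a + b)) c = 0.
Proof.
move=> et ad; apply: jordan_star_sub_eq0r; apply: phi_scale_inj.
rewrite phi_jordan et scale_jordan_starDl -!phi_jordan -ad.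
by rewrite -scale_jordan_starDl.
Qed.

(** By surjectivity the sum of two images is an image phi t, so that
    additivity at (a, b) amounts to identifying t. *)
Lemma additive_at_separated a b :
    (forall t, phi t = phi a + phi b -> t - (a + b) = 0) -> additive_at a b.
Proof.
have [g _ gK] := phi_bij => sep.
have /subr0_eq e := sep _ (gK (phi a + phi b)).
by rewrite /additive_at -e gK.
Qed.

(** ** Additivity along the Peirce decomposition *)

Section Peirce.
Variables P Q : A.
Hypotheses (proj_P : projection P) (proj_Q : projection Q) (PDQ : P + Q = 1).

Let sP : star P = P. Proof. by case: proj_P. Qed.
Let sQ : star Q = Q. Proof. by case: proj_Q. Qed.
Let PP : P * P = P. Proof. by case: proj_P. Qed.
Let QQ : Q * Q = Q. Proof. by case: proj_Q. Qed.
Let PQ : P * Q = 0.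
Proof. by apply: (addrI P); rewrite addr0 -{1}PP -mulrDr PDQ mulr1. Qed.
Let QP : Q * P = 0.
Proof. by apply: (addIr P); rewrite add0r -{2}PP -mulrDl addrC PDQ mul1r. Qed.
Let xPP x : x * P * P = x * P. Proof. by rewrite -mulrA PP. Qed.
Let xQQ x : x * Q * Q = x * Q. Proof. by rewrite -mulrA QQ. Qed.
Let xPQ x : x * P * Q = 0. Proof. by rewrite -mulrA PQ mulr0. Qed.
Let xQP x : x * Q * P = 0. Proof. by rewrite -mulrA QP mulr0. Qed.

(* Expands products of sums into words in P, Q and other letters, and contracts
   adjacent projections in them. *)
Let wordE := (@starM R A, @starD R A, @starN R A, @starK R A, sP, sQ,
  @mulrDl A, @mulrDr A, @mulNr A, @mulrN A, @mulrA A, PP, QQ, PQ, QP,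
  xPP, xQQ, xPQ, xQP, @mul0r A, @mulr0 A, @addr0 A, @add0r A, @subr0 A,
  @sub0r A, @oppr0 A).

Lemma peirce_decomposition x :
  x = P * x * P + (P * x * Q + Q * x * P) + Q * x * Q.
Proof.
rewrite -[LHS]mul1r -[LHS]mulr1 -PDQ !(mulrDl, mulrDr).
by rewrite !addrA [in LHS](addrAC (P * x * P)).
Qed.

Lemma jordan_complementary_eq0 x :
  jordan_star P x = 0 -> jordan_star Q x = 0 -> x = 0.
Proof.
move=> Px Qx; apply: double_inj.
by rewrite -jordan_star1l -PDQ jordan_starDl Px Qx !addr0.
Qed.

(** Left products with P - Q annihilate both off-diagonal corners, and right
    products with P or with Q annihilate one of them. *)
Lemma additive_at_offdiag x y : additive_at (P * x * Q) (Q * y * P).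
Proof.
apply: additive_at_separated => t et; set r := t - _.
have dr : jordan_star (P - Q) r = 0.
  apply: (jordan_separatel et); rewrite /jordan_star !wordE.
  by rewrite subrr addNr scaler0; exact: additive_at0l.
have rP : jordan_star r P = 0.
  apply: (jordan_separater et); rewrite {1}/jordan_star !wordE scaler0.
  exact: additive_at0l.
have rQ : jordan_star r Q = 0.
  apply: (jordan_separater et).
  rewrite [X in additive_at _ (_ *: X)]/jordan_star !wordE scaler0.
  exact: additive_at0r.
have PrP : P * r * P = 0.
  apply: double_inj; rewrite addr0 -[RHS](mul0r P) -[in RHS](mulr0 P) -dr.
  by rewrite /jordan_star !wordE.
have QrQ : Q * r * Q = 0.
  apply: double_inj; rewrite addr0 -[RHS]oppr0 -[in RHS](mul0r Q).
  by rewrite -[in RHS](mulr0 Q) -dr /jordan_star !wordE opprD !opprK.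
have QrP : Q * r * P = 0.
  rewrite -[RHS](mul0r P) -[in RHS](mulr0 Q) -rP.
  by rewrite /jordan_star !wordE.
have PrQ : P * r * Q = 0.
  rewrite -[RHS](mul0r Q) -[in RHS](mulr0 P) -rQ.
  by rewrite /jordan_star !wordE.
by rewrite (peirce_decomposition r) PrP PrQ QrP QrQ !addr0.
Qed.

(** Left products with Q annihilate the corner, and left products with P - Q
    annihilate the off-diagonal part. *)
Lemma additive_at_corner_offdiag x y z :
  additive_at (P * x * P) (P * y * Q + Q * z * P).
Proof.
apply: additive_at_separated => t et; set r := t - _.
have Qr : jordan_star Q r = 0.
  apply: (jordan_separatel et); rewrite {1}/jordan_star !wordE scaler0.
  exact: additive_at0l.
have dr : jordan_star (P - Q) r = 0.
  apply: (jordan_separatel et).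
  rewrite [X in additive_at _ (_ *: X)]/jordan_star !wordE.
  rewrite addrC addrACA subrr addNr addr0 scaler0; exact: additive_at0r.
apply: jordan_complementary_eq0 => //.
by rewrite -[P](subrK Q) jordan_starDl dr Qr addr0.
Qed.

Lemma additive_at_offdiag_corner x y z :
  additive_at (P * x * Q + Q * y * P) (Q * z * Q).
Proof.
apply: additive_at_separated => t et; set r := t - _.
have Pr : jordan_star P r = 0.
  apply: (jordan_separatel et).
  rewrite [X in additive_at _ (_ *: X)]/jordan_star !wordE scaler0.
  exact: additive_at0r.
have dr : jordan_star (P - Q) r = 0.
  apply: (jordan_separatel et); rewrite {1}/jordan_star !wordE.
  rewrite addrC addrACA subrr addNr addr0 scaler0; exact: additive_at0l.
apply: jordan_complementary_eq0 => //; apply/eqP.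
rewrite -oppr_eq0 -jordan_starNl -[- Q](addKr P) jordan_starDl dr.
by rewrite jordan_starNl Pr oppr0 addr0.
Qed.

(** Left products with P or Q annihilate one of the diagonal corners, which
    reduces four components to three. *)
Lemma phi_peirce x :
  phi x = phi (P * x * P) + (phi (P * x * Q) + phi (Q * x * P))
          + phi (Q * x * Q).
Proof.
rewrite {1}(peirce_decomposition x) -additive_at_offdiag.
rewrite -additive_at_corner_offdiag.
apply: additive_at_separated => t et; set r := t - _.
apply: jordan_complementary_eq0.
  apply: (jordan_separatel et).
  rewrite [X in additive_at _ (_ *: X)]/jordan_star !wordE scaler0.
  exact: additive_at0r.
apply: (jordan_separatel et); rewrite /jordan_star !wordE.
have := additive_at_offdiag_corner (k *: x) (k *: x) (k *: (x + x)).
rewrite -!scale_corner !wordE -scalerDr.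
by rewrite [Q * x * P + _]addrC.
Qed.

(** The product of P + a and Q + b, for a and b in P A Q, is
    a + b + a* + b a*, whose P A Q component is a + b.  Its two factors are sums
    across different corners, where [phi] is known to be additive; expanding
    their images and comparing with the Peirce components of the product leaves
    the additivity at (a, b). *)
Lemma additive_at_offdiag_same x y : additive_at (P * x * Q) (P * y * Q).
Proof.
(* Dividing by k absorbs the factor that the hypothesis on phi carries. *)
suff scaled a b : additive_at (k *: (P * a * Q)) (k *: (P * b * Q)).
  have := scaled (k^-1 *: x) (k^-1 *: y).
  by rewrite -!scale_corner !scalerA mulfV // !scale1r.
have uE : phi (P + P * a * Q) = phi P + phi (P * a * Q).
  by rewrite [LHS]phi_peirce !wordE phi0 !addr0.
have vE : phi (Q + P * b * Q) = phi Q + phi (P * b * Q).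
  by rewrite [LHS]phi_peirce !wordE phi0 !addr0 !add0r addrC.
have := phi_jordan (P + P * a * Q) (Q + P * b * Q).
rewrite uE vE [in RHS]scale_jordan_starDl !(scale_jordan_starDr k (phi _)).
rewrite -!phi_jordan /jordan_star !wordE scaler0 phi0 add0r.
rewrite [LHS]phi_peirce !scale_corner -!scale_corner !wordE.
have -> : phi (k *: (P * a * Q + Q * star a * P)) =
    phi (k *: (P * a * Q)) + phi (k *: (Q * star a * P)).
  by rewrite scalerDr !scale_corner; exact: additive_at_offdiag.
rewrite scaler0 phi0 addr0 addrC !addrA => /addIr/addIr.
by rewrite /additive_at -scalerDr [P * a * Q + _]addrC [RHS]addrC.
Qed.

(** Right products with P T Q move the problem into P A Q; letting T vary, they
    detect every element of P A P. *)
Lemma additive_at_diag x y :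
    (forall X : A, (forall T, X * T * Q = 0) -> X = 0) ->
  additive_at (P * x * P) (P * y * P).
Proof.
move=> sepQ; apply: additive_at_separated => t et; set r := t - _.
have Qr : jordan_star Q r = 0.
  apply: (jordan_separatel et); rewrite {1}/jordan_star !wordE scaler0.
  exact: additive_at0l.
have QrQ : Q * r * Q = 0.
  apply: double_inj; rewrite addr0 -[RHS](mul0r Q) -[in RHS](mulr0 Q) -Qr.
  by rewrite /jordan_star !wordE.
have QrP : Q * r * P = 0.
  by rewrite -[RHS](mul0r P) -[in RHS](mulr0 Q) -Qr /jordan_star !wordE.
have PrQ : P * r * Q = 0.
  by rewrite -[RHS](mul0r Q) -[in RHS](mulr0 P) -Qr /jordan_star !wordE.
have rE : r = P * r * P.
  by rewrite {1}(peirce_decomposition r) PrQ QrP QrQ !addr0.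
rewrite rE; apply: sepQ => T.
have : jordan_star r (P * T * Q) = 0.
  apply: (jordan_separater et).
  have := additive_at_offdiag_same (k *: (x * P * T)) (k *: (y * P * T)).
  by rewrite -!scale_corner /jordan_star !wordE.
by rewrite rE /jordan_star !wordE.
Qed.

End Peirce.

Lemma phi_additive P Q :
    projection P -> projection Q -> P + Q = 1 ->
    (forall X : A, (forall T, X * T * P = 0) -> X = 0) ->
    (forall X : A, (forall T, X * T * Q = 0) -> X = 0) ->
  {morph phi : x y / x + y}.
Proof.
move=> pP pQ PDQ sepP sepQ x y; have QDP : Q + P = 1 by rewrite addrC.
have peirceE := phi_peirce pP pQ PDQ.
rewrite (peirceE (x + y)) (peirceE x) (peirceE y) !mulrDr !mulrDl.
rewrite (additive_at_diag pP pQ PDQ) // (additive_at_diag pQ pP QDP) //.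
rewrite (additive_at_offdiag_same pP pQ PDQ).
rewrite (additive_at_offdiag_same pQ pP QDP).
by rewrite [X in _ + X + _]addrACA [X in X + _]addrACA [LHS]addrACA.
Qed.

End Additivity.

(** * Multiplicativity *)

Section Multiplicativity.
Variables (R : realType) (A A' : cstarAlgType R) (phi : A -> A').
Hypotheses (phi_bij : bijective phi) (phi1 : phi 1 = 1).
Hypothesis phiD : {morph phi : x y / x + y}.
Hypothesis phiJ : {morph phi : a b / jordan_star a b}.
Implicit Types (a b c x y t : A).

Lemma morph0 : phi 0 = 0.
Proof. by apply: (addIr (phi 0)); rewrite -phiD !add0r. Qed.

Lemma morphN x : phi (- x) = - phi x.
Proof. by apply: (addIr (phi x)); rewrite -phiD !addNr morph0. Qed.

Lemma morphB x y : phi (x - y) = phi x - phi y.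
Proof. by rewrite phiD morphN. Qed.

Lemma morph_star x : phi (star x) = star (phi x).
Proof.
have := phiJ x 1; rewrite phi1 !jordan_star1r phiD; exact: addrI.
Qed.

Let i1 : A := 'i *: 1.
Let j : A' := phi i1.

Let i1l x : i1 * x = 'i *: x. Proof. by rewrite /i1 -scalerAl mul1r. Qed.
Let i1r x : x * i1 = 'i *: x. Proof. by rewrite /i1 -scalerAr mulr1. Qed.
Let star_i1 : star i1 = - i1.
Proof. by rewrite /i1 starZ star1 conjCi scaleNr. Qed.
Let ii x : 'i *: ('i *: x) = - x.
Proof. by rewrite scalerA -expr2 sqrCi scaleN1r. Qed.

Let star_j : star j = - j.
Proof. by rewrite -morph_star star_i1 morphN. Qed.

(* The product of i with any element vanishes, because i is central and
   skew-adjoint; so does the product of j with any image. *)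
Let j_central (y : A') : j * y = y * j.
Proof.
have [g _ gK] := phi_bij; rewrite -[y]gK.
have := phiJ i1 (g y).
rewrite /jordan_star star_i1 i1l mulrN i1r subrr morph0 -/j star_j mulrN.
by move/esym/subr0_eq.
Qed.

Lemma phi_i_selfadjoint h : star h = h -> phi ('i *: h) = j * phi h.
Proof.
move=> sh; apply: double_inj; have := phiJ h i1.
rewrite /jordan_star -morph_star sh i1r i1l phiD => ->.
by rewrite -/j j_central.
Qed.

(** Bracketing twice with i P multiplies an off-diagonal element by i^2 = -1,
    and its image in the corner by j^2. *)
Lemma phi_i_square_corner P (T : A') : projection P ->
  (j * j + 1) * phi P * T * phi (1 - P) = 0.
Proof.
case=> sP PP; have [g _ gK] := phi_bij.
set Q1 := phi P.
have sQ1 : star Q1 = Q1 by rewrite -morph_star sP.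
have QQ : Q1 * Q1 = Q1.
  apply: double_inj; have := phiJ P P.
  by rewrite /jordan_star sP PP -/Q1 sQ1 phiD.
rewrite morphB phi1 -/Q1.
set w := Q1 * T * (1 - Q1); set y := g w.
have Qw : Q1 * w = w by rewrite /w !mulrA QQ.
have wQ : w * Q1 = 0 by rewrite /w -mulrA mulrBl mul1r QQ subrr mulr0.
(* Preimages of off-diagonal elements are off-diagonal: these are the fixed
   points of the product with P. *)
have yE : P * y + y * P = y.
  apply: (bij_inj phi_bij); have := phiJ P y.
  by rewrite /jordan_star sP -/Q1 sQ1 gK Qw wQ addr0.
have PyP : P * y * P = 0.
  apply: (addIr (P * y * P)); rewrite add0r -[RHS]mulrA -{3}yE.
  by rewrite mulrDl mulrDr !mulrA PP -[P * y * P * P]mulrA PP.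
have iP : phi ('i *: P) = j * Q1 by apply: phi_i_selfadjoint.
have siP : star ('i *: P) = - ('i *: P) by rewrite starZ conjCi sP scaleNr.
have step x : phi ('i *: (P * x - x * P)) = j * (Q1 * phi x - phi x * Q1).
  have := phiJ ('i *: P) x; rewrite /jordan_star siP mulrN -scalerAl -scalerAr.
  rewrite -scalerBr => ->.
  rewrite -morph_star siP morphN iP mulrN mulrBr !mulrA.
  by rewrite -(j_central (phi x)).
have := step ('i *: (P * y - y * P)).
rewrite (step y) gK Qw wQ subr0 mulrA -(j_central Q1) -mulrA Qw.
rewrite -[j * w * Q1]mulrA wQ mulr0 subr0.
rewrite -scalerAr -scalerAl -scalerBr ii.
rewrite mulrBr mulrBl !mulrA PP -[y * P * P]mulrA PP PyP subr0 sub0r opprK yE.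
rewrite morphN gK => /eqP; rewrite eq_sym -addr_eq0 => /eqP e.
transitivity ((j * j + 1) * w); first by rewrite /w !mulrA.
by rewrite mulrDl mul1r {1}/w !mulrA.
Qed.

Lemma phi_mul P Q :
    projection P -> projection Q -> P + Q = 1 ->
    (forall Y : A', (forall T, Y * T * phi P = 0) -> Y = 0) ->
    (forall Y : A', (forall T, Y * T * phi Q = 0) -> Y = 0) ->
  {morph phi : x y / x * y}.
Proof.
move=> pP pQ PDQ sepP sepQ.
have eQ : Q = 1 - P by rewrite -PDQ addrC addKr.
have eP : P = 1 - Q by rewrite -PDQ addrK.
have jjP : (j * j + 1) * phi P = 0.
  by apply: sepQ => T; rewrite eQ phi_i_square_corner.
have jjQ : (j * j + 1) * phi Q = 0.
  by apply: sepP => T; rewrite [in phi P]eP phi_i_square_corner.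
have jj : j * j = -1.
  apply/eqP; rewrite -addr_eq0 -[_ + 1]mulr1 -[X in _ * X == _]phi1 -PDQ phiD.
  by rewrite mulrDr jjP jjQ addr0.
have phi_i x : phi ('i *: x) = j * phi x.
  have re : phi ('i *: (x + star x)) = j * phi (x + star x).
    by apply: phi_i_selfadjoint; rewrite starD starK addrC.
  (* x - star x is i times a selfadjoint element, and j * j = -1. *)
  have im : phi ('i *: (x - star x)) = j * phi (x - star x).
    have sa : star ('i *: (x - star x)) = 'i *: (x - star x).
      by rewrite starZ conjCi starD starN starK scaleNr -scalerN opprB.
    have := phi_i_selfadjoint sa; rewrite ii morphN => e.
    by rewrite -[phi (x - _)]opprK e mulrN mulrA jj mulN1r opprK.
  apply: double_inj; rewrite -mulrDr -!phiD.
  have xx : x + x = (x + star x) + (x - star x) by rewrite addrACA subrr addr0.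
  by rewrite -scalerDr xx scalerDr [in LHS]phiD re im -mulrDr -phiD.
move=> x y; apply: double_inj.
have sum : phi (x * y + y * star x) = phi x * phi y + phi y * star (phi x).
  exact: phiJ.
(* For i x in place of x, the identity sum becomes j times this one. *)
have dif : phi (x * y - y * star x) = phi x * phi y - phi y * star (phi x).
  suff : j * phi (x * y - y * star x) =
         j * (phi x * phi y - phi y * star (phi x)).
    move/(congr1 (fun z => - (j * z))).
    by rewrite !mulrA jj !mulN1r !opprK.
  rewrite -phi_i mulrBr; have := phiJ ('i *: x) y.
  rewrite /jordan_star -morph_star starZ conjCi scaleNr mulrN.
  rewrite -scalerAl -scalerAr -scalerBr => ->.
  by rewrite morphN !phi_i mulrN !mulrA morph_star -(j_central (phi y)).
rewrite -phiD.
have -> : x * y + x * y = (x * y + y * star x) + (x * y - y * star x).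
  by rewrite addrACA subrr addr0.
by rewrite phiD sum dif addrACA subrr addr0.
Qed.

End Multiplicativity.

Lemma qstar_morph (R : realType) (A A' : cstarAlgType R) (phi : A -> A') n :
    (0 < n)%N -> {morph phi : a b / jordan_star a b} ->
  star_jordan_nmap n phi.
Proof.
move=> n_gt0 phiJ [[|x s] //= /eqP sz]; first by rewrite -sz in n_gt0.
by elim: s x {sz} => //= y s IH x; rewrite IH phiJ.
Qed.

Theorem corollary3p1 (n : nat) (hn : (2 <= n)%N)
    (R : realType) (A A' : cstarAlgType R)
    (P1 P2 : A)
    (hP1 : nontrivial_projection P1)
    (hP2 : nontrivial_projection P2)
    (hP12 : P2 = 1 - P1)
    (phi : A -> A')
    (hA : forall P : A, P = P1 \/ P = P2 ->
      forall X : A, (forall T : A, X * T * P = 0) -> X = 0)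
    (hA' : forall P : A, P = P1 \/ P = P2 ->
      forall Y : A', (forall T : A', Y * T * phi P = 0) -> Y = 0) :
  [/\ bijective phi, phi 1 = 1 & star_jordan_nmap n phi]
  <-> star_ring_isomorphism phi.
Proof.
split=> [[phi_bij phi1 phi_q] | [phi_bij phiD phiM phiS]]; last first.
  split=> //.
    have [g _ gK] := phi_bij.
    by rewrite -[LHS]mul1r -{1}[1]gK -phiM mulr1 gK.
  by apply: qstar_morph => [|a b]; [exact: ltnW | rewrite phiD !phiM phiS].
have [[pP1 _ _] [pP2 _ _]] := (hP1, hP2).
have P12 : P1 + P2 = 1 by rewrite hP12 addrC subrK.
have [m en] : exists m, n = m.+2 by case: (n) hn => [|[|m]] // _; exists m.
have scaledJ a b :
    phi (jordan_star a b *+ 2 ^ m) = jordan_star (phi a) (phi b) *+ 2 ^ m.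
  have sz : size (ncons m 1 [:: a; b]) == n by rewrite size_ncons addn2 en.
  have := phi_q (Tuple sz); rewrite /= qstar_ones => ->.
  by rewrite -qstar_ones; congr qstar; elim: (m) => //= i ->; rewrite phi1.
pose k : R[i] := (2 ^ m)%:R.
have k_neq0 : k != 0 by rewrite pnatr_eq0 expn_eq0.
have phiJk a b : phi (k *: jordan_star a b) = k *: jordan_star (phi a) (phi b).
  by rewrite !scaler_nat.
have phiD : {morph phi : x y / x + y}.
  by apply: (phi_additive k_neq0 phi_bij phiJk pP1 pP2) => //;
    apply: hA; [left | right].
have phiMn x l : phi (x *+ l) = phi x *+ l.
  elim: l => [|l IH]; first by rewrite !mulr0n (morph0 phiD).
  by rewrite !mulrS phiD IH.
have phiJ : {morph phi : a b / jordan_star a b}.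
  move=> a b; apply: (scalerI k_neq0).
  by rewrite -phiJk !scaler_nat phiMn.
split=> //; last exact: morph_star phi1 phiD phiJ.
by apply: (phi_mul phi_bij phi1 phiD phiJ pP1 pP2) => //;
  apply: hA'; [left | right].
Qed.
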